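(* Let $X,Y$ be real polynomials in two variables vanishing at the origin, and consider the polar equation $$\frac{dr}{d\theta}=\frac{R(r\cos\theta,r\sin\theta)}{T(r\cos\theta,r\sin\theta)}$$ of the system $\dot x=X(x,y)$, $\dot y=Y(x,y)$, where $R=(xX+yY)/r$ and $T=(xY-yX)/r^2$. Let $r=f(\sin\theta)+g(\sin\theta)\cos\theta$ be a star-like periodic orbit of this equation, where $f,g\in\mathcal{C}^\infty([-1,1])$. Then $f(u)$ and $g(u)$ are solutions, for $u\in[-1,1]$, of $$\begin{cases}(1-u^2)T_1f'(u)+(1-u^2)T_0g'(u)-uT_0g(u)-R_0=0,\\ T_0f'(u)+(1-u^2)T_1g'(u)-uT_1g(u)-R_1=0,\end{cases}$$ where $T_i=T_i(f(u),g(u),u)$ and $R_i=R_i(f(u),g(u),u)$ for $i=0,1$.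
   Context: A periodic orbit of $\dot x=X$, $\dot y=Y$ is star-like if it does not intersect $\{T=0\}$; it then corresponds to a smooth $2\pi$-periodic solution $r=F(\theta)>0$ of the polar equation. A function belongs to $\mathcal{C}^\infty([-1,1])$ if it is $\mathcal{C}^\infty$ in an open neighborhood of $[-1,1]$. Definition of $R_0,R_1,T_0,T_1$. Since $X,Y$ vanish at the origin, $R(r\cos\theta,r\sin\theta)=\cos\theta\,X(r\cos\theta,r\sin\theta)+\sin\theta\,Y(r\cos\theta,r\sin\theta)$ and $T(r\cos\theta,r\sin\theta)=\big(\cos\theta\,Y(r\cos\theta,r\sin\theta)-\sin\theta\,X(r\cos\theta,r\sin\theta)\big)/r$ are polynomials in $r,\cos\theta,\sin\theta$. Introduce variables $f,g,u,v$ with $v^2=1-u^2$, and substitute $\cos\theta=v$, $\sin\theta=u$, $r=f+vg$ (so $x=(f+vg)v$, $y=(f+vg)u$). Using $v^{2k}=(1-u^2)^k$ and $v^{2k+1}=v(1-u^2)^k$, the resulting expressions are written uniquely as $$R=R_0(f,g,u)+v\,R_1(f,g,u),\qquad T=T_0(f,g,u)+v\,T_1(f,g,u),$$ with $R_0,R_1,T_0,T_1$ polynomials in $f,g,u$. *)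

(* Defs.v *)
From mathcomp Require Import all_boot all_order all_algebra.
From mathcomp Require Import mpoly.
From mathcomp Require Import classical_sets reals topology normedtype.
From mathcomp Require Import derive realfun trigo.

Set Implicit Arguments.
Unset Strict Implicit.
Unset Printing Implicit Defensive.

Import Order.TTheory GRing.Theory Num.Theory.
Import numFieldNormedType.Exports.

Local Open Scope classical_set_scope.
Local Open Scope ring_scope.

Definition eval2 (K : realType) (P : {mpoly K[2]}) (x y : K) : K :=
  P.@[fun i : 'I_2 => [:: x; y]`_i].

Definition eval3 (K : realType) (P : {mpoly K[3]}) (f g u : K) : K :=
  P.@[fun i : 'I_3 => [:: f; g; u]`_i].

Definition Rfun (K : realType) (X Y : {mpoly K[2]}) (x y : K) : K :=
  (x * eval2 X x y + y * eval2 Y x y) / Num.sqrt (x ^+ 2 + y ^+ 2).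

Definition Tfun (K : realType) (X Y : {mpoly K[2]}) (x y : K) : K :=
  (x * eval2 Y x y - y * eval2 X x y) / (x ^+ 2 + y ^+ 2).

(* C^oo on an open neighbourhood of A: since U is open, the iterated
   derivatives at points of U only depend on the restriction of h to U. *)
Definition smooth_near (K : realType) (A : set K) (h : K -> K) : Prop :=
  exists U : set K, [/\ open U, A `<=` U &
    forall (n : nat) (x : K), U x -> derivable (h^`(n)%classic) x 1].

(* The condition T <> 0 along r = F(theta) is star-likeness; it also makes the
   quotient R/T meaningful. *)
Definition polar_solution (K : realType) (X Y : {mpoly K[2]})
    (F : K -> K) : Prop :=
  forall theta : K,
    let x := F theta * cos theta in
    let y := F theta * sin theta in
    Tfun X Y x y != 0 /\
    is_derive theta (1 : K) F (Rfun X Y x y / Tfun X Y x y).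

Definition star_like_periodic_orbit (K : realType) (X Y : {mpoly K[2]})
    (F : K -> K) : Prop :=
  [/\ smooth_near setT F,
      forall theta : K, F (theta + 2 * pi) = F theta,
      forall theta : K, 0 < F theta &
      polar_solution X Y F].

(* {poly {mpoly K[2]}} is the ring of polynomials in r (the main variable),
   c = 'X_0 (for cos theta) and s = 'X_1 (for sin theta). *)
Definition cosP {K : realType} : {poly {mpoly K[2]}} := ('X_0)%:P.
Definition sinP {K : realType} : {poly {mpoly K[2]}} := ('X_1)%:P.

(* P(r c, r s) *)
Definition polarP (K : realType) (P : {mpoly K[2]}) : {poly {mpoly K[2]}} :=
  mmap (fun a : K => (a%:MP)%:P)
       (fun i : 'I_2 => [:: 'X * cosP; 'X * sinP]`_i) P.

Definition Rpolar (K : realType) (X Y : {mpoly K[2]}) : {poly {mpoly K[2]}} :=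
  cosP * polarP X + sinP * polarP Y.

(* drop_poly 1 divides by r; the division is exact when X and Y vanish at
   the origin. *)
Definition Tpolar (K : realType) (X Y : {mpoly K[2]}) : {poly {mpoly K[2]}} :=
  drop_poly 1 (cosP * polarP Y - sinP * polarP X).

(* {poly {mpoly K[3]}} is the ring of polynomials in v (the main variable),
   f = 'X_0, g = 'X_1 and u = 'X_2. *)
Definition fP {K : realType} : {mpoly K[3]} := 'X_0.
Definition gP {K : realType} : {mpoly K[3]} := 'X_1.
Definition uP {K : realType} : {mpoly K[3]} := 'X_2.

(* c := v, s := u, r := f + v g *)
Definition substP (K : realType) (P : {poly {mpoly K[2]}}) :
    {poly {mpoly K[3]}} :=
  (map_poly (mmap (fun a : K => (a%:MP)%:P)
                  (fun i : 'I_2 => [:: 'X; uP%:P]`_i)) P).[fP%:P + 'X * gP%:P].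

(* Reduction modulo v^2 = 1 - u^2: every class has a unique representative
   of degree at most 1 in v, namely the remainder of the division by this
   monic polynomial. *)
Definition reduceP (K : realType) (P : {poly {mpoly K[3]}}) :
    {poly {mpoly K[3]}} :=
  Pdiv.Ring.rmodp P ('X^2 - (1 - uP ^+ 2)%:P).

Definition R_ (K : realType) (i : nat) (X Y : {mpoly K[2]}) : {mpoly K[3]} :=
  (reduceP (substP (Rpolar X Y)))`_i.

Definition T_ (K : realType) (i : nat) (X Y : {mpoly K[2]}) : {mpoly K[3]} :=
  (reduceP (substP (Tpolar X Y)))`_i.

(* Main.v *)
Require Import Defs.
From HB Require Import structures.
From mathcomp Require Import all_boot all_order all_algebra.
From mathcomp Require Import mpoly.
From mathcomp Require Import boolp classical_sets functions set_interval.
From mathcomp Require Import reals topology normedtype.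
From mathcomp Require Import derive realfun trigo.
From mathcomp Require Import ring lra.

(** Along the orbit put [u = sin theta] and [v = cos theta].  The chain rule
    gives [dr/dtheta = f'(u) v + g'(u) v^2 - g(u) u], while the numerator and
    the denominator of the polar equation are [R0 + v R1] and [T0 + v T1].
    The polar equation [(dr/dtheta) T = R] is therefore an identity between
    expressions in [v] with coefficients depending on [u], valid at every
    point of the circle [v^2 = 1 - u^2] since [theta] is arbitrary
    ([polar_solution_fg]).  Reducing it with [v^2 = 1 - u^2] turns it into
    [A(u) + v B(u) = 0], where [A] and [B] are the left-hand sides of the two
    equations of the system.  Both [v] and [-v] lie above the same [u], so
    [A(u) = 0] and [v B(u) = 0]; hence [B] vanishes on the open interval, where
    [v <> 0], and at the endpoints by continuity
    ([system_of_identity_mod_circle]).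

    What links this to the polynomials [R_ i] and [T_ i], which are defined by
    formal substitution and Euclidean division, is that each formal step
    becomes the expected one under evaluation: substitution composes with
    evaluation because evaluation is a ring morphism ([peval_substP]), and
    the remainder has the same value as the dividend wherever
    [v^2 = 1 - u^2] ([peval_reduceP]). *)

Import Order.TTheory GRing.Theory Num.Theory.
Import numFieldNormedType.Exports.

Local Open Scope classical_set_scope.
Local Open Scope ring_scope.

(** * Evaluation of univariate polynomials with multivariate coefficients *)

Lemma rmorph_mmap_meval (n : nat) (R : comNzRingType) (S : nzRingType)
    (phi : {rmorphism S -> R}) (h : R -> S) (k : 'I_n -> S) (P : {mpoly R[n]}) :
  cancel h phi -> phi (mmap h k P) = P.@[phi \o k].
Proof.
move=> hK; rewrite mevalE rmorph_sum; apply: eq_bigr => m _.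
by rewrite rmorphM hK rmorph_prod; under eq_bigr do rewrite rmorphXn.
Qed.

Section EvalPolyMpoly.
Context {R : comNzRingType} {n : nat} (w : 'I_n -> R) (t : R).

(** A composite of ring morphisms rather than a plain formula, so that it
    inherits a ring morphism structure and commutes with substitutions. *)
Definition peval : {poly {mpoly R[n]}} -> R :=
  horner_eval t \o map_poly (meval w).

HB.instance Definition _ :=
  GRing.RMorphism.copy peval (horner_eval t \o map_poly (meval w)).

Lemma pevalD : {morph peval : p q / p + q}. Proof. exact: rmorphD. Qed.
Lemma pevalB : {morph peval : p q / p - q}. Proof. exact: rmorphB. Qed.
Lemma pevalM : {morph peval : p q / p * q}. Proof. exact: rmorphM. Qed.

Lemma pevalC p : peval p%:P = p.@[w].
Proof. by rewrite /peval /= map_polyC /horner_eval hornerC. Qed.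

Lemma pevalX : peval 'X = t.
Proof. by rewrite /peval /= map_polyX /horner_eval hornerX. Qed.

Lemma peval_lin a p b q :
  peval (a%:P * p + b%:P * q) = a.@[w] * peval p + b.@[w] * peval q.
Proof. by rewrite pevalD !pevalM !pevalC. Qed.

Lemma peval_mmap (m : nat) (k : 'I_m -> {poly {mpoly R[n]}})
    (P : {mpoly R[m]}) :
  peval (mmap (fun a : R => (a%:MP)%:P) k P) = P.@[peval \o k].
Proof. by apply: rmorph_mmap_meval => a; rewrite /= pevalC mevalC. Qed.

End EvalPolyMpoly.

Definition pt2 {K : realType} (x y : K) (i : 'I_2) : K := [:: x; y]`_i.
Definition pt3 {K : realType} (x y z : K) (i : 'I_3) : K := [:: x; y; z]`_i.

(** * Values of the polar polynomials *)

Lemma peval_polarP (K : realType) (P : {mpoly K[2]}) (r c s : K) :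
  peval (pt2 c s) r (polarP P) = eval2 P (r * c) (r * s).
Proof.
rewrite /polarP peval_mmap.
apply: meval_eq => -[[|[|//]] ?] /=;
  by rewrite pevalM pevalX pevalC mevalXU.
Qed.

Lemma peval_Rpolar (K : realType) (X Y : {mpoly K[2]}) (r c s : K) :
  peval (pt2 c s) r (Rpolar X Y) =
  c * eval2 X (r * c) (r * s) + s * eval2 Y (r * c) (r * s).
Proof.
rewrite /Rpolar peval_lin !mevalXU.
by congr (_ * _ + _ * _); exact: peval_polarP.
Qed.

(** The polynomial divided by [r] has constant term [c Y(0,0) - s X(0,0)],
    whose value is 0; so dropping it loses nothing and multiplying back by [r]
    recovers the numerator, also when [r = 0]. *)
Lemma peval_Tpolar (K : realType) (X Y : {mpoly K[2]}) (r c s : K) :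
    eval2 X 0 0 = 0 -> eval2 Y 0 0 = 0 ->
  r * peval (pt2 c s) r (Tpolar X Y) =
  c * eval2 Y (r * c) (r * s) - s * eval2 X (r * c) (r * s).
Proof.
move=> X0 Y0; pose p : {poly {mpoly K[2]}} := cosP * polarP Y - sinP * polarP X.
have evp t : peval (pt2 c s) t p =
    c * eval2 Y (t * c) (t * s) - s * eval2 X (t * c) (t * s).
  rewrite /p -mulNr -polyCN peval_lin mevalN mulNr !mevalXU.
  by congr (_ * _ - _ * _); exact: peval_polarP.
have split t : peval (pt2 c s) t p =
    (p`_0).@[pt2 c s] + t * peval (pt2 c s) t (drop_poly 1 p).
  rewrite -{1}(poly_take_drop 1 p) expr1 pevalD pevalM pevalX mulrC.
  have -> : take_poly 1 p = (p`_0)%:P.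
    by apply/polyP => -[|i]; rewrite coef_take_poly coefC.
  by rewrite pevalC addrC.
(* At [t = 0] the decomposition isolates the value of the constant term. *)
have := split 0; rewrite evp !mul0r X0 Y0 !mulr0 subr0 addr0 => p0.
by rewrite -evp split -p0 add0r.
Qed.

Lemma peval_substP (K : realType) (P : {poly {mpoly K[2]}}) (v f g u : K) :
  peval (pt3 f g u) v (substP P) = peval (pt2 v u) (f + v * g) P.
Proof.
rewrite /substP -horner_map -map_poly_comp /=.
rewrite pevalD pevalM pevalX !pevalC !mevalXU /peval /= /horner_eval.
congr (_.[_]); apply: eq_map_poly => p /=.
rewrite [LHS]peval_mmap.
apply: meval_eq => -[[|[|//]] ?] /=; first exact: pevalX.
by rewrite pevalC mevalXU.
Qed.

(** The divisor vanishes at points with [v^2 = 1 - u^2], so that there the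
    polynomial and its remainder, of degree at most 1 in [v], agree. *)
Lemma peval_reduceP (K : realType) (P : {poly {mpoly K[3]}}) (v f g u : K) :
    v ^+ 2 = 1 - u ^+ 2 ->
  peval (pt3 f g u) v P =
  eval3 (reduceP P)`_0 f g u + v * eval3 (reduceP P)`_1 f g u.
Proof.
move=> vE; pose d : {poly {mpoly K[3]}} := 'X^2 - (1 - uP ^+ 2)%:P.
rewrite /reduceP -/d.
have sC : (size (- (1 - uP ^+ 2 : {mpoly K[3]})%:P)%R
           < size ('X^2 : {poly {mpoly K[3]}}))%N.
  rewrite size_polyN size_polyXn.
  exact: leq_ltn_trans (size_polyC_leq1 _) _.
have sd : size d = 3%N by rewrite /d size_polyDl // size_polyXn.
have dm : d \is monic by rewrite /d monicE lead_coefDl // lead_coefXn.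
have evd : peval (pt3 f g u) v d = 0.
  rewrite /d pevalB expr2 pevalM pevalX pevalC.
  by rewrite mevalB meval1 expr2 mevalM mevalXU /pt3 /= -!expr2 vE subrr.
rewrite {1}(Pdiv.RingMonic.rdivp_eq dm P).
rewrite pevalD pevalM evd mulr0 add0r.
have := monic_neq0 dm; rewrite -(Pdiv.Ring.ltn_rmodp P) sd.
move: (Pdiv.Ring.rmodp P d) => q sq.
have {1}-> : q = (q`_0)%:P + 'X * (q`_1)%:P.
  apply/polyP => i; rewrite coefD coefC coefXM.
  case: i => [|[|i]] /=; rewrite ?coefC ?addr0 ?add0r //=.
  by apply/nth_default/(@leq_trans 2).
by rewrite pevalD pevalM pevalX !pevalC.
Qed.

(** Positivity of [r] serves to identify [sqrt (x^2 + y^2)] with [r]. *)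
Lemma RfunE (K : realType) (X Y : {mpoly K[2]}) (v f g u : K) :
    v ^+ 2 = 1 - u ^+ 2 -> 0 < f + g * v ->
  let r := f + g * v in
  Rfun X Y (r * v) (r * u) =
  eval3 (R_ 0 X Y) f g u + v * eval3 (R_ 1 X Y) f g u.
Proof.
move=> vE r_gt0 r; rewrite -peval_reduceP // peval_substP peval_Rpolar.
rewrite [v * g]mulrC -/r /Rfun.
have -> : (r * v) ^+ 2 + (r * u) ^+ 2 = r ^+ 2.
  by rewrite !exprMn -mulrDr vE subrK mulr1.
rewrite sqrtr_sqr gtr0_norm // -!mulrA -mulrDr mulrAC mulfV ?mul1r //.
exact: lt0r_neq0.
Qed.

Lemma TfunE (K : realType) (X Y : {mpoly K[2]}) (v f g u : K) :
    eval2 X 0 0 = 0 -> eval2 Y 0 0 = 0 ->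
    v ^+ 2 = 1 - u ^+ 2 -> 0 < f + g * v ->
  let r := f + g * v in
  Tfun X Y (r * v) (r * u) =
  eval3 (T_ 0 X Y) f g u + v * eval3 (T_ 1 X Y) f g u.
Proof.
move=> X0 Y0 vE r_gt0 r; rewrite -peval_reduceP // peval_substP.
rewrite [v * g]mulrC -/r /Tfun.
have -> : (r * v) ^+ 2 + (r * u) ^+ 2 = r ^+ 2.
  by rewrite !exprMn -mulrDr vE subrK mulr1.
have r_neq0 : r != 0 by exact: lt0r_neq0.
rewrite -!mulrA -mulrBr -peval_Tpolar // mulrA -expr2 mulrAC mulfV ?mul1r //.
by rewrite expf_neq0.
Qed.

(** * Continuity and differentiability *)

Lemma continuous_meval (T : topologicalType) (K : realType) (n : nat)
    (P : {mpoly K[n]}) (w : T -> 'I_n -> K) (a : T) :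
    (forall i, {for a, continuous (w ^~ i)}) ->
  {for a, continuous (fun x => P.@[w x])}.
Proof.
move=> cw; elim/mpolyind: P => [|c m P _ _ IH].
  have -> : (fun x => 0.@[w x]) = cst 0 by apply/funext => x; rewrite meval0.
  exact: cst_continuous.
have -> : (fun x => (c *: 'X_[m] + P).@[w x]) =
    (fun x => c * \prod_i w x i ^+ m i + P.@[w x]).
  by apply/funext => x; rewrite mevalD mevalZ mevalX.
apply: continuousD IH; apply: continuousM; first exact: cst_continuous.
elim: (index_enum _) => [|i r IHr].
  have -> : (fun x => \prod_(i <- [::]) w x i ^+ m i) = cst 1.
    by apply/funext => x; rewrite big_nil.
  exact: cst_continuous.
have -> : (fun x => \prod_(j <- i :: r) w x j ^+ m j) =
    (fun x => w x i ^+ m i * \prod_(j <- r) w x j ^+ m j).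
  by apply/funext => x; rewrite big_cons.
apply: continuousM IHr.
exact: (continuous_comp (cw i) (@exprn_continuous _ _ _)).
Qed.

(** Every point of the closed interval is a one-sided limit of points of the
    open one: from the right if it is not [q], from the left if it is [q]. *)
Lemma continuous_eq0_itv (K : realType) (p q a : K) (h : K -> K) :
    p < q -> p <= a <= q -> {for a, continuous h} ->
    (forall x, p < x < q -> h x = 0) -> h a = 0.
Proof.
move=> pq /andP[pa aq] ch h0.
have [aq'|] := ltP a q.
  have ha : h x @[x --> a^'+] --> h a by exact: cvg_at_right_filter.
  suff : h x @[x --> a^'+] --> (0 : K) by move/(cvg_unique _ ha); apply.
  apply: (@cvg_trans _ ((fun=> 0 : K) @ a^'+)); last exact: cvg_cst.
  apply: near_eq_cvg; near=> x; apply/esym/h0/andP; split.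
    by apply: le_lt_trans pa _; near: x; exact: nbhs_right_gt.
  by near: x; exact: nbhs_right_lt.
move=> qa; have pa' : p < a by exact: lt_le_trans pq qa.
have ha : h x @[x --> a^'-] --> h a by exact: cvg_at_left_filter.
suff : h x @[x --> a^'-] --> (0 : K) by move/(cvg_unique _ ha); apply.
apply: (@cvg_trans _ ((fun=> 0 : K) @ a^'-)); last exact: cvg_cst.
apply: near_eq_cvg; near=> x; apply/esym/h0/andP; split.
  by near: x; exact: nbhs_left_gt.
by apply: lt_le_trans aq; near: x; exact: nbhs_left_lt.
Unshelve. all: by end_near. Qed.

Lemma smooth_near_derive1 (K : realType) (A : set K) (h : K -> K) (a : K) :
    smooth_near A h -> A a ->
  [/\ is_derive a 1 h (h^`()%classic a), {for a, continuous h} &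
      {for a, continuous (h^`()%classic)}].
Proof.
move=> [U [_ AU dh]] /AU Ua.
have d0 := dh 0%N a Ua; have d1 := dh 1%N a Ua.
split.
- by rewrite derive1E; exact/derivableP.
- exact/differentiable_continuous/derivable1_diffP.
- exact/differentiable_continuous/derivable1_diffP.
Qed.

(** * The polar equation along the orbit *)

(** [acos v] has the right cosine and its sine is [|u|]; changing the sign of
    the angle corrects the sine when [u < 0]. *)
Lemma unit_circle_cos_sin (K : realType) (u v : K) :
  v ^+ 2 = 1 - u ^+ 2 -> exists2 theta : K, cos theta = v & sin theta = u.
Proof.
move=> vE; have v1 : -1 <= v <= 1 by apply/andP; split; nra.
have sin_acosv : sin (acos v) = `|u|.
  by rewrite sin_acos // vE opprB addrC subrK sqrtr_sqr.
have [u_ge0|u_lt0] := lerP 0 u.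
  by exists (acos v); rewrite ?acosK ?in_itv // sin_acosv ger0_norm.
exists (- acos v); first by rewrite cosN acosK // in_itv.
by rewrite sinN sin_acosv ltr0_norm // opprK.
Qed.

(** The polar equation at an angle with [cos theta = v] and [sin theta = u],
    cleared of its denominator.  Both square roots [v] of [1 - u^2] are
    covered, which is what allows the even and odd parts in [v] to be
    separated afterwards. *)
Lemma polar_solution_fg (K : realType) (X Y : {mpoly K[2]}) (f g : K -> K)
    (u v f' g' : K) :
    let F theta := f (sin theta) + g (sin theta) * cos theta in
    eval2 X 0 0 = 0 -> eval2 Y 0 0 = 0 ->
    (forall theta, 0 < F theta) -> polar_solution X Y F ->
    is_derive u 1 f f' -> is_derive u 1 g g' -> v ^+ 2 = 1 - u ^+ 2 ->
  (f' * v + (g' * v ^+ 2 - g u * u)) *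
    (eval3 (T_ 0 X Y) (f u) (g u) u + v * eval3 (T_ 1 X Y) (f u) (g u) u) =
  eval3 (R_ 0 X Y) (f u) (g u) u + v * eval3 (R_ 1 X Y) (f u) (g u) u.
Proof.
move=> F X0 Y0 F_gt0 FE df dg vE.
have [t tv tu] := unit_circle_cos_sin _ _ _ vE.
have := F_gt0 t; rewrite /F tv tu => r_gt0.
have dft : is_derive t 1 (f \o sin) (f' * v).
  by apply: is_derive1_comp; rewrite ?tu // -tv; exact: is_derive_sin.
have dgt : is_derive t 1 (g \o sin) (g' * v).
  by apply: is_derive1_comp; rewrite ?tu // -tv; exact: is_derive_sin.
have F'E : 'D_1 F t = f' * v + (g' * v ^+ 2 - g u * u).
  have -> : F = (f \o sin) + (g \o sin) * cos by [].
  by rewrite derive_val /= tv tu /GRing.scale /=; ring.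
have [] := FE t; rewrite /F tv tu RfunE // TfunE // => T_neq0 dF.
by rewrite -F'E (@derive_val _ _ _ _ _ _ _ dF) divfK.
Qed.

(** * Separation of the two parts of the identity *)

(** Comparing [v] with [-v] only gives [v B(u) = 0] for the second equation,
    which is void at [u = 1] and [u = -1]; the continuity hypotheses, on
    exactly the functions that occur in [B], recover those two points. *)
Lemma system_of_identity_mod_circle (K : realType)
    (df dg g R0 R1 T0 T1 : K -> K) :
    {in `[-1, 1], continuous df} -> {in `[-1, 1], continuous dg} ->
    {in `[-1, 1], continuous g} -> {in `[-1, 1], continuous R1} ->
    {in `[-1, 1], continuous T0} -> {in `[-1, 1], continuous T1} ->
    (forall u v, -1 <= u <= 1 -> v ^+ 2 = 1 - u ^+ 2 ->
       (df u * v + (dg u * v ^+ 2 - g u * u)) * (T0 u + v * T1 u) =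
       R0 u + v * R1 u) ->
  forall u, -1 <= u <= 1 ->
    (1 - u ^+ 2) * T1 u * df u + (1 - u ^+ 2) * T0 u * dg u
      - u * T0 u * g u - R0 u = 0 /\
    T0 u * df u + (1 - u ^+ 2) * T1 u * dg u - u * T1 u * g u - R1 u = 0.
Proof.
move=> cdf cdg cg cR1 cT0 cT1 E u u1.
pose A x := (1 - x ^+ 2) * T1 x * df x + (1 - x ^+ 2) * T0 x * dg x
  - x * T0 x * g x - R0 x.
pose B x := T0 x * df x + (1 - x ^+ 2) * T1 x * dg x - x * T1 x * g x - R1 x.
have AB x v : -1 <= x <= 1 -> v ^+ 2 = 1 - x ^+ 2 -> A x + v * B x = 0.
  move=> x1 vE; have := E x v x1 vE.
  by rewrite /A /B -vE => /eqP; rewrite -subr_eq0 => /eqP <-; ring.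
have AvB x : -1 <= x <= 1 -> A x = 0 /\ Num.sqrt (1 - x ^+ 2) * B x = 0.
  move=> x1.
  have vE : Num.sqrt (1 - x ^+ 2) ^+ 2 = 1 - x ^+ 2.
    by rewrite sqr_sqrtr // subr_ge0; case/andP: x1 => ? ?; nra.
  have := AB x _ x1 vE; rewrite -sqrrN in vE; have := AB x _ x1 vE.
  by rewrite mulNr => h1 h2; split; lra.
split; first exact: (AvB u u1).1.
apply: (@continuous_eq0_itv _ (-1) 1 u B) => [|//||x]; first by lra.
- have uI : u \in `[-1, 1] by rewrite in_itv.
  have cid : {for u, continuous (fun x : K => x)} by exact: cvg_id.
  have c1 : {for u, continuous (fun x : K => 1 - x ^+ 2)}.
    by apply: continuousB; [exact: cst_continuous|exact: exprn_continuous].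
  move: (cdf _ uI) (cdg _ uI) (cg _ uI) (cR1 _ uI) (cT0 _ uI) (cT1 _ uI).
  move=> {}cdf {}cdg {}cg {}cR1 {}cT0 {}cT1.
  rewrite /B; apply: continuousB cR1.
  apply: continuousB; last by apply: continuousM cg; exact: continuousM.
  apply: continuousD; first exact: continuousM.
  by apply: continuousM cdg; exact: continuousM.
- move=> /andP[x_gt x_lt]; have x1 : -1 <= x <= 1 by rewrite !ltW.
  have [_ /eqP] := AvB x x1; rewrite mulf_eq0 => /orP[|/eqP //].
  by rewrite sqrtr_eq0 => h; exfalso; nra.
Qed.

Theorem theorem2p6 (K : realType) (X Y : {mpoly K[2]}) (f g : K -> K)
    (hX : eval2 X 0 0 = 0) (hY : eval2 Y 0 0 = 0)
    (hf : smooth_near `[-1, 1] f) (hg : smooth_near `[-1, 1] g)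
    (hF : star_like_periodic_orbit X Y
            (fun theta : K => f (sin theta) + g (sin theta) * cos theta)) :
  forall u : K, -1 <= u <= 1 ->
    let R0 := eval3 (R_ 0 X Y) (f u) (g u) u in
    let R1 := eval3 (R_ 1 X Y) (f u) (g u) u in
    let T0 := eval3 (T_ 0 X Y) (f u) (g u) u in
    let T1 := eval3 (T_ 1 X Y) (f u) (g u) u in
    let f' := f^`()%classic u in
    let g' := g^`()%classic u in
    (1 - u ^+ 2) * T1 * f' + (1 - u ^+ 2) * T0 * g' - u * T0 * g u - R0 = 0 /\
    T0 * f' + (1 - u ^+ 2) * T1 * g' - u * T1 * g u - R1 = 0.
Proof.
case: hF => _ _ F_gt0 FE.
have cP (P : {mpoly K[3]}) :
    {in `[-1, 1], continuous (fun x => eval3 P (f x) (g x) x)}.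
  move=> u uI; apply: continuous_meval => -[[|[|[|//]]] ?].
  - by have [_] := smooth_near_derive1 _ _ _ _ hf uI.
  - by have [_] := smooth_near_derive1 _ _ _ _ hg uI.
  - exact: cvg_id.
apply: (@system_of_identity_mod_circle _ (f^`()%classic) (g^`()%classic) g
  (fun x => eval3 (R_ 0 X Y) (f x) (g x) x)
  (fun x => eval3 (R_ 1 X Y) (f x) (g x) x)
  (fun x => eval3 (T_ 0 X Y) (f x) (g x) x)
  (fun x => eval3 (T_ 1 X Y) (f x) (g x) x)).
- by move=> u uI; have [] := smooth_near_derive1 _ _ _ _ hf uI.
- by move=> u uI; have [] := smooth_near_derive1 _ _ _ _ hg uI.
- by move=> u uI; have [] := smooth_near_derive1 _ _ _ _ hg uI.
- exact: cP.
- exact: cP.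
- exact: cP.
- move=> u v u1 vE; have uI : u \in `[-1, 1] by rewrite in_itv.
  have [df _ _] := smooth_near_derive1 _ _ _ _ hf uI.
  have [dg _ _] := smooth_near_derive1 _ _ _ _ hg uI.
  exact: polar_solution_fg hX hY F_gt0 FE df dg vE.
Qed.
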